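(* (i) The 81-set $\mathcal{O}_2\cup\mathcal{O}_5$ is a quartic hypersurface $Q_4(x)=0$ in $\operatorname{PG}(7,2)$ (that is, its unique reduced polynomial $Q_4$ has degree 4) which is invariant under the action of $\mathcal{G}_{\mathcal{S}}$. (ii) In the coordinates $x_1,\ldots,x_8$ with respect to the basis $e_1,\ldots,e_8$ the quartic polynomial $Q_4$ has the explicit form $$Q_4=P_2''+P_3'+P_4'''+P_4^{\mathrm{v}}.$$
   Context: Everything is over $\operatorname{GF}(2)$. Let $V_2$ be a 2-dimensional vector space over $\operatorname{GF}(2)$ with nonzero vectors $u_0,u_1,u_2$ (so $u_2=u_0+u_1$), and $V_8=V_2\otimes V_2\otimes V_2$. Points of $\operatorname{PG}(7,2)=\mathbb{P}V_8$ are identified with nonzero vectors of $V_8$. Put $E_{ijk}=u_i\otimes u_j\otimes u_k$ for $i,j,k\in\{0,1,2\}$. The Segre variety is the 27-point set $\mathcal{S}=\mathcal{S}_{1,1,1}(2)=\{E_{ijk}\}$; $\mathcal{G}_{\mathcal{S}}$ is its stabilizer in $\operatorname{GL}(V_8)$, equal to $\mathcal{N}\rtimes\operatorname{Sym}(3)$ where $\mathcal{N}=\operatorname{GL}(V_2)^3$ acts by maps $a_1\otimes a_2\otimes a_3$ and $\operatorname{Sym}(3)$ permutes the tensor factors. $\mathcal{O}_5=\mathcal{S}$; $\mathcal{O}_2$ is the set of points outside $\mathcal{S}$ lying in one of the nine 3-flats spanned by the 9-point subsets of $\mathcal{S}$ obtained by fixing one of the three indices of $E_{ijk}$ (both are $\mathcal{G}_{\mathcal{S}}$-orbits,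 of sizes 27 and 54). Every point set $\psi\subseteq\operatorname{PG}(7,2)$ is the set of points $x$ with $Q(x)=0$ for a unique reduced polynomial $Q$ with zero constant term, i.e. a sum of squarefree monomials $x_{i_1}\cdots x_{i_k}$, $k\ge1$, $i_1<\cdots<i_k$; the degree of $Q$ does not depend on the choice of basis. Coordinates are with respect to the basis $e_1=E_{000}$, $e_2=E_{100}$, $e_3=E_{110}$, $e_4=E_{010}$, $e_5=E_{101}$, $e_6=E_{001}$, $e_7=E_{011}$, $e_8=E_{111}$. Writing $ij$, $ijk$, $ijkl$ for the monomials $x_ix_j$, $x_ix_jx_k$, $x_ix_jx_kx_l$: $P_2''=18+27+36+45$; $P_3'=135+137+157+357+246+248+268+468$; $P_4'''=1357+2468$; $P_4^{\mathrm{v}}=1248+1268+1468+1358+1378+1578+1237+1257+2357+2467+2478+2678+2346+2368+3468+1356+1367+3567+1345+1457+3457+2456+2458+4568$. *)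

(* Defs.v *)
From HB Require Import structures.
From mathcomp Require Import all_boot all_order all_algebra all_fingroup.
From mathcomp Require Import mxtens mpoly.

Set Implicit Arguments.
Unset Strict Implicit.
Unset Printing Implicit Defensive.

Import GRing.Theory.
Local Open Scope ring_scope.

(* V8 is the Kronecker model of V2 (x) V2 (x) V2, with 8 convertible to
   2 * 2 * 2.  Over GF(2) a projective point has exactly one nonzero
   representative, so point sets of PG(7,2) are sets of nonzero vectors. *)
Notation V2 := 'rV['F_2]_2.
Notation V8 := 'rV['F_2]_8.

(* Matrices act on row vectors from the right. *)
Definition gl_act (g : {'GL_8['F_2]}) (x : V8) : V8 := x *m GLval g.

Section Segre.
(* u lists the three nonzero vectors of V2. *)
Variable u : 'I_3 -> V2.

Definition E (i j k : 'I_3) : V8 := u i *t u j *t u k.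

Definition segre : {set V8} := [set E t.1.1 t.1.2 t.2 | t : 'I_3 * 'I_3 * 'I_3].

Definition segre_flats : seq {vspace V8} :=
  [seq <<[seq E i j k | j <- enum 'I_3, k <- enum 'I_3]>>%VS | i <- enum 'I_3]
  ++ [seq <<[seq E i j k | i <- enum 'I_3, k <- enum 'I_3]>>%VS | j <- enum 'I_3]
  ++ [seq <<[seq E i j k | i <- enum 'I_3, j <- enum 'I_3]>>%VS | k <- enum 'I_3].

Definition O5 : {set V8} := segre.

Definition O2 : {set V8} :=
  [set x | [&& x != 0, x \notin segre
             & has (fun F : {vspace V8} => x \in F) segre_flats]].

Definition stab_segre : {set {'GL_8['F_2]}} :=
  [set g | gl_act g @: segre == segre].

Definition e_basis : 8.-tuple V8 :=
  [tuple E 0 0 0; E 1 0 0; E 1 1 0; E 0 1 0; E 1 0 1; E 0 0 1; E 0 1 1; E 1 1 1].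

End Segre.

Definition reduced (Q : {mpoly 'F_2[8]}) : Prop :=
  Q@_0%MM = 0 /\ (forall m, m \in msupp Q -> forall i, (m i <= 1)%N).

Definition reduced_equation (b : 8.-tuple V8) (psi : {set V8})
    (Q : {mpoly 'F_2[8]}) : Prop :=
  reduced Q
  /\ psi = [set x | (x != 0) && (Q.@[fun i => coord b i x] == 0)].

(* The squarefree monomial with 1-based indices s: mon [:: 1; 8] is x_1 x_8. *)
Definition mon (s : seq nat) : {mpoly 'F_2[8]} :=
  \prod_(i < 8 | i.+1 \in s) 'X_i.

Definition P2'' : {mpoly 'F_2[8]} :=
  \sum_(s <- [:: [:: 1; 8]; [:: 2; 7]; [:: 3; 6]; [:: 4; 5]]%N) mon s.

Definition P3' : {mpoly 'F_2[8]} :=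
  \sum_(s <- [:: [:: 1; 3; 5]; [:: 1; 3; 7]; [:: 1; 5; 7]; [:: 3; 5; 7];
                 [:: 2; 4; 6]; [:: 2; 4; 8]; [:: 2; 6; 8]; [:: 4; 6; 8]]%N)
    mon s.

Definition P4''' : {mpoly 'F_2[8]} :=
  \sum_(s <- [:: [:: 1; 3; 5; 7]; [:: 2; 4; 6; 8]]%N) mon s.

Definition P4v : {mpoly 'F_2[8]} :=
  \sum_(s <- [:: [:: 1; 2; 4; 8]; [:: 1; 2; 6; 8]; [:: 1; 4; 6; 8];
                 [:: 1; 3; 5; 8]; [:: 1; 3; 7; 8]; [:: 1; 5; 7; 8];
                 [:: 1; 2; 3; 7]; [:: 1; 2; 5; 7]; [:: 2; 3; 5; 7];
                 [:: 2; 4; 6; 7]; [:: 2; 4; 7; 8]; [:: 2; 6; 7; 8];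
                 [:: 2; 3; 4; 6]; [:: 2; 3; 6; 8]; [:: 3; 4; 6; 8];
                 [:: 1; 3; 5; 6]; [:: 1; 3; 6; 7]; [:: 3; 5; 6; 7];
                 [:: 1; 3; 4; 5]; [:: 1; 4; 5; 7]; [:: 3; 4; 5; 7];
                 [:: 2; 4; 5; 6]; [:: 2; 4; 5; 8]; [:: 4; 5; 6; 8]]%N)
    mon s.

Definition Q4 : {mpoly 'F_2[8]} := P2'' + P3' + P4''' + P4v.

(* Main.v *)
Require Import Defs.
From HB Require Import structures.
From mathcomp Require Import all_boot all_order all_algebra all_fingroup.
From mathcomp Require Import mxtens mpoly.
Import GRing.Theory.
Local Open Scope ring_scope.

(** A point of the 81-set lies in the span of the nine Segre points with one
    index fixed.  That span is a copy of V2 (x) V2, and every tensor there is a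
    sum of two pure ones, so the 81-set consists of the nonzero sums p + q of
    two Segre points sharing an index ([mem_O2_O5P]).

    Invariance.  Two Segre points sharing an index are exactly those joined
    through a third one by two lines contained in the Segre variety (or by
    degenerate such lines), [share_indexP].  Points p and q lie on such a line
    exactly when p + q is zero or a Segre point ([collinearE]), a condition that
    any linear map preserving the variety respects.  So the stabilizer needs no
    explicit description.

    The quartic.  In the basis e_1, ..., e_8 a vector is a list of eight bits,
    addition is exclusive or, and both membership in the 81-set and the value
    of Q4 become boolean functions of the list.  Their agreement on all 256
    lists and the size 81 are settled by evaluation ([Q4_bits],
    [card_O2_O5_bits]).

    Uniqueness and degree.  A squarefree polynomial over GF(2) that vanishes
    everywhere is zero ([squarefree_eq0]), so a point set has at most one
    reduced equation in given coordinates.  Substituting linear forms and then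
    replacing x^k by x turns the equation in one basis into the equation in
    another without raising the degree ([reduced_equation_change]).  Applied in
    both directions, this shows that the degree 4 read off from Q4 is the degree
    in every basis. *)

Set Implicit Arguments.
Unset Strict Implicit.
Unset Printing Implicit Defensive.

(** * Squarefree polynomials over GF(2) *)

Lemma F2_natE (a : 'F_2) : a = (a != 0)%:R.
Proof. by case: a => [[|[|]]] //= ?; apply: val_inj. Qed.

Lemma F2_expr_gt0 (a : 'F_2) k : a ^+ k = a ^+ (0 < k)%N.
Proof.
case: k => [|k] //=; rewrite (F2_natE a).
by case: (a != 0); rewrite ?expr1n // !expr0n.
Qed.

Section SquarefreeRepresentatives.
Variable n : nat.
Implicit Types (Q : {mpoly 'F_2[n]}) (m : 'X_{1..n}).

Definition squarefree Q : Prop := forall m, m \in msupp Q -> forall i, (m i <= 1)%N.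

(** A monomial m of least degree in the support is detected by evaluating at the
    0/1-vector of its variables: any other squarefree monomial that does not
    vanish there properly divides m. *)
Lemma squarefree_eq0 Q : squarefree Q -> (forall v, Q.@[v] = 0) -> Q = 0.
Proof.
move=> sqQ Q0; apply/mpolyP => m; rewrite mcoeff0.
elim: {m}_.+1 {-2}m (ltnSn (mdeg m)) => // d IHd m; rewrite ltnS => led.
apply/eqP; apply: contraT => /[dup] Qm; rewrite -mcoeff_msupp => Sm.
(* [m i] is 0 or 1, so [(m i)%:R] is the indicator of the variables of m. *)
have := Q0 (fun i => (m i)%:R); rewrite mevalE (bigD1_seq m) ?msupp_uniq //=.
rewrite [\prod_i _]big1 ?mulr1 => [|i _]; last first.
  by have := sqQ _ Sm i; case: (m i) => [|[|]].
rewrite big_seq_cond big1 ?addr0 => [Qm0|m' /andP[Sm' nem]].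
  by rewrite Qm0 eqxx in Qm.
have [le_m'm|] := boolP (m' <= m)%MM; last first.
  case/mnm_lepP/forallP; rewrite negb_forall => /existsP[i].
  rewrite -ltnNge => lt_mi; have le1 := sqQ _ Sm' i.
  have mi0 : m i = 0%N by case: (m i) lt_mi (leq_trans lt_mi le1).
  by rewrite (bigD1 i) //= mi0 expr0n gtn_eqF -?mi0 // mul0r mulr0.
rewrite IHd ?mul0r //; apply: leq_trans led.
rewrite -(submK le_m'm) mdegD -[ltnLHS]add0n ltn_add2r lt0n mdeg_eq0.
by apply: contra nem => /eqP sub0; rewrite -(submK le_m'm) sub0 add0m.
Qed.

Definition mnm_red m : 'X_{1..n} := [multinom nat_of_bool (0 < m i)%N | i < n].

(** The coefficients of distinct monomials of Q with the same variables are added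
    up, so this is the remainder modulo the relations x_i^2 = x_i. *)
Definition mpoly_red Q : {mpoly 'F_2[n]} :=
  \sum_(m <- msupp Q) Q@_m *: 'X_[mnm_red m].

Lemma meval_red Q v : (mpoly_red Q).@[v] = Q.@[v].
Proof.
rewrite raddf_sum mevalE; apply: eq_bigr => m _ /=.
rewrite mevalZ mevalX; congr (_ * _); apply: eq_bigr => i _.
by rewrite mnmE -F2_expr_gt0.
Qed.

Lemma msupp_red Q m :
  m \in msupp (mpoly_red Q) -> exists2 m', m' \in msupp Q & m = mnm_red m'.
Proof.
rewrite mcoeff_msupp raddf_sum /= => nz.
suff /hasP[m' Sm' /eqP <-]: has (fun m' => mnm_red m' == m) (msupp Q).
  by exists m'.
apply: contraR nz => /hasPn no; rewrite big_seq big1 // => m' /no /negbTE E'.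
by rewrite mcoeffZ mcoeffX E' mulr0.
Qed.

Lemma squarefree_red Q : squarefree (mpoly_red Q).
Proof. by move=> m /msupp_red[m' _ ->] i; rewrite mnmE leq_b1. Qed.

Lemma msize_red_le Q : (msize (mpoly_red Q) <= msize Q)%N.
Proof.
rewrite msizeE; apply/bigmax_leqP_seq => m /msupp_red[m' Sm' ->] _.
apply: leq_trans (msize_mdeg_lt Sm'); rewrite ltnS !mdegE leq_sum // => i _.
by rewrite mnmE; case: (m' i).
Qed.
End SquarefreeRepresentatives.

(** * Reduced equations and change of basis *)

(** A monomial of degree d turns into a product of d polynomials of degree at
    most 1, that is, of [msize] at most 2. *)
Lemma msize_comp_linear n k (Q : {mpoly 'F_2[n]}) (lq : n.-tuple {mpoly 'F_2[k]}) :
  (forall i, msize (tnth lq i) <= 2)%N -> (msize (Q \mPo lq) <= msize Q)%N.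
Proof.
move=> lq2; rewrite comp_mpolyE.
apply: (big_ind (fun p : {mpoly 'F_2[k]} => msize p <= msize Q)%N).
- by rewrite msize0.
- by move=> p q Hp Hq; apply: leq_trans (msizeD_le _ _) _; rewrite geq_max Hp.
move=> m _; have [Sm|] := boolP (m \in msupp Q); last first.
  by rewrite -mcoeff_eq0 => /eqP ->; rewrite scale0r msize0.
apply: leq_trans (msizeZ_le _ _) (leq_trans _ (msize_mdeg_lt Sm)).
rewrite mdegE; apply: (big_ind2 (fun (p : {mpoly 'F_2[k]}) d => msize p <= d.+1)%N).
- by rewrite msize1.
- move=> p d q e Hp Hq; have [->|p0] := eqVneq p 0; first by rewrite mul0r msize0.
  have [->|q0] := eqVneq q 0; first by rewrite mulr0 msize0.
  by rewrite msizeM //; move: (leq_add Hp Hq); rewrite addSn addnS; case: addn.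
move=> i _; elim: (m i) => [|d IHd]; first by rewrite expr0 msize1.
have [->|l0] := eqVneq (tnth lq i) 0; first by rewrite expr0n msize0.
rewrite exprS msizeM ?expf_neq0 //; move: (leq_add (lq2 i) IHd).
by rewrite addSn; case: addn.
Qed.

(** The zero vector carries no point, so the value there is what the
    normalization of the constant term controls. *)
Lemma meval_coord0 (b : 8.-tuple V8) (Q : {mpoly 'F_2[8]}) :
  Q.@[fun i => coord b i 0] = Q@_0%MM.
Proof.
rewrite (@meval_eq _ _ _ (fun=> 0)) => [|i]; last exact: linear0.
rewrite {1 2}[Q]mpolyE !raddf_sum /=; apply: eq_bigr => m _.
rewrite mevalZ mevalX mcoeffZ mcoeffX; congr (_ * _).
have [->|] := eqVneq; first by rewrite big1 // => i _; rewrite mnm0E.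
rewrite -mdeg_eq0 mdegE sum_nat_eq0 => /forallPn[i] /= mi.
by rewrite (bigD1 i) //= expr0n (negbTE mi) mul0r.
Qed.

(** This carries both existence of the equation in an arbitrary basis and, used
    in the two directions, independence of the degree from the basis. *)
Lemma reduced_equation_change (b b' : 8.-tuple V8) (psi : {set V8})
    (Q : {mpoly 'F_2[8]}) :
  basis_of fullv b -> reduced_equation b' psi Q ->
  exists2 Q', reduced_equation b psi Q' & (msize Q' <= msize Q)%N.
Proof.
move=> bb [[Q0 _] eqQ].
(* The old coordinates as linear forms in the new ones. *)
pose lq := [tuple \sum_(j < 8) coord b' i b`_j *: 'X_j | i < 8]
  : 8.-tuple {mpoly 'F_2[8]}.
pose Q' := mpoly_red (Q \mPo lq).
have evQ x : Q'.@[fun i => coord b i x] = Q.@[fun i => coord b' i x].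
  rewrite meval_red comp_mpoly_meval; apply: meval_eq => i.
  rewrite tnth_mktuple {2}(coord_basis bb (memvf x)) raddf_sum linear_sum /=.
  by apply: eq_bigr => j _; rewrite mevalZ mevalXU linearZ /= mulrC.
exists Q'.
  split; last by rewrite {1}eqQ; apply/setP => x; rewrite !inE evQ.
  by split; [rewrite -(meval_coord0 b) evQ meval_coord0 | apply: squarefree_red].
apply: (leq_trans (msize_red_le (Q \mPo lq))); apply: msize_comp_linear => i.
rewrite tnth_mktuple; apply: (big_ind (fun p : {mpoly 'F_2[8]} => msize p <= 2)%N).
- by rewrite msize0.
- by move=> p q Hp Hq; apply: leq_trans (msizeD_le _ _) _; rewrite geq_max Hp.
by move=> j _; apply: leq_trans (msizeZ_le _ _) _; rewrite msizeX mdeg1.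
Qed.

Section Uniqueness.
Variables (b : 8.-tuple V8) (psi : {set V8}).
Hypothesis basis_b : basis_of fullv b.

Lemma coord_surj (v : 'I_8 -> 'F_2) : exists x, forall i, coord b i x = v i.
Proof.
exists (\sum_(i < 8) v i *: b`_i) => i; apply: coord_sum_free; exact: basis_free basis_b.
Qed.

(** Over GF(2) the zero set determines the values of Q, except at the zero vector,
    where the constant term does. *)
Lemma reduced_equation_uniq Q Q' :
  reduced_equation b psi Q -> reduced_equation b psi Q' -> Q = Q'.
Proof.
move=> [[Q0 sqQ] eQ] [[Q'0 sqQ'] eQ']; apply/eqP; rewrite -subr_eq0; apply/eqP.
apply: squarefree_eq0 => [m|v].
  move/msuppB_le; rewrite mem_cat => /orP[]; [exact: sqQ | exact: sqQ'].
have [x xv] := coord_surj v; rewrite -(meval_eq _ xv) mevalB.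
have [->|x0] := eqVneq x 0; first by rewrite !meval_coord0 Q0 Q'0 subrr.
have: (x \in psi) = (x \in psi) by []; rewrite {1}eQ eQ' !inE x0 /= => eq0.
rewrite [Q.@[_]]F2_natE [Q'.@[_]]F2_natE.
by rewrite eq0 subrr.
Qed.
End Uniqueness.

(** * Pure tensors over GF(2) *)

Lemma F2_addvv (V : lmodType 'F_2) (x : V) : x + x = 0.
Proof.
by rewrite -[x]scale1r -scalerDl (_ : 1 + 1 = 0 :> 'F_2) ?scale0r //; apply: val_inj.
Qed.

Lemma tensmxDl m n (x y : 'rV['F_2]_m) (z : 'rV['F_2]_n) :
  (x + y) *t z = x *t z + y *t z.
Proof. by apply/matrixP => i j; rewrite !mxE mulrDl. Qed.

(** A name for the triple product with its dimension fixed to 8; once opaque, it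
    keeps unification from unfolding tensors into their entries. *)
Definition tens3 (x y z : V2) : V8 := x *t y *t z.

Lemma tens3E (x x' y y' z : V2) :
  (x *t y + x' *t y' : 'rV_4) *t z = tens3 x y z + tens3 x' y' z.
Proof. exact: tensmxDl. Qed.

Lemma tens3Dl x x' y z : tens3 (x + x') y z = tens3 x y z + tens3 x' y z.
Proof. by apply/matrixP => i j; rewrite !mxE /= !mulrDl. Qed.

Lemma tens3Dm x y y' z : tens3 x (y + y') z = tens3 x y z + tens3 x y' z.
Proof. by apply/matrixP => i j; rewrite !mxE /= mulrDr mulrDl. Qed.

Lemma tens3Dr x y z z' : tens3 x y (z + z') = tens3 x y z + tens3 x y z'.
Proof. by apply/matrixP => i j; rewrite !mxE /= mulrDr. Qed.

Lemma tens3Z a x y z : a *: tens3 x y z = tens3 (a *: x) y z.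
Proof. by apply/matrixP => i j; rewrite !mxE /= !mulrA. Qed.

Lemma tens3_comb a b x y z t :
  tens3 (a *: x + b *: y) z t = a *: tens3 x z t + b *: tens3 y z t.
Proof. by rewrite tens3Dl -!tens3Z. Qed.

(** The left-hand side is the order of the e_n; the right-hand side collects the
    terms that share their last two tensor factors. *)
Lemma regroup8 (V : zmodType) (a b c d e f g h : V) :
  a + (b + (c + (d + (e + (f + (g + (h + 0)))))))
  = (a + b + (d + c)) + (f + e + (g + h)).
Proof. by rewrite addr0 (addrCA c) (addrCA e) !addrA. Qed.

Lemma E_tens3 u i j k : E u i j k = tens3 (u i) (u j) (u k).
Proof. by []. Qed.

Local Opaque tens3.

Lemma I3P (i : 'I_3) : [\/ i = 0, i = 1 | i = 2].
Proof.
by case: i => [[|[|[|]]]] //= lt; [apply: Or31|apply: Or32|apply: Or33]; apply: val_inj.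
Qed.

Lemma I3_ind2 (P : 'I_3 -> Prop) : P 0 -> P 1 -> (P 0 -> P 1 -> P 2) -> forall i, P i.
Proof. by move=> P0 P1 P2 i; have [->|->|->] := I3P i; auto. Qed.

(** Proof principle for statements on E_ijk that are stable under
    u_2 = u_0 + u_1 in each tensor factor. *)
Lemma I3_ind3 (P : 'I_3 -> 'I_3 -> 'I_3 -> Prop) :
  P 0 0 0 -> P 0 0 1 -> P 0 1 0 -> P 0 1 1 -> P 1 0 0 -> P 1 0 1 -> P 1 1 0 -> P 1 1 1 ->
  (forall j k, P 0 j k -> P 1 j k -> P 2 j k) ->
  (forall i k, P i 0 k -> P i 1 k -> P i 2 k) ->
  (forall i j, P i j 0 -> P i j 1 -> P i j 2) -> forall i j k, P i j k.
Proof.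
move=> P000 P001 P010 P011 P100 P101 P110 P111 Pl Pm Pr i j k; move: i j.
by elim/I3_ind2: k => [||P0 P1]; last (by move=> i j; apply: Pr);
   move=> i j; move: i; elim/I3_ind2: j => [||P0 P1];
   try (by move=> i; apply: Pm); elim/I3_ind2; auto.
Qed.

Lemma mem_span_grid (V : vectType 'F_2) (f : 'I_3 -> 'I_3 -> V) j k :
  f j k \in <<[seq f j k | j <- enum 'I_3, k <- enum 'I_3]>>%VS.
Proof. by apply: memv_span; apply: allpairs_f; rewrite mem_enum. Qed.

(** For f j k = u_j (x) u_k this says that a tensor in V2 (x) V2 has rank at most
    2.  It is written as u_0 (x) y + u_1 (x) z; when y or z vanishes, the missing
    second summand comes from u_0 + u_1 + u_2 = 0. *)
Lemma span_grid_sum2 (V : vectType 'F_2) (f : 'I_3 -> 'I_3 -> V) :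
    (forall k, f 2 k = f 0 k + f 1 k) -> (forall j, f j 2 = f j 0 + f j 1) ->
  forall x, x \in <<[seq f j k | j <- enum 'I_3, k <- enum 'I_3]>>%VS ->
  exists j k j' k', x = f j k + f j' k'.
Proof.
move=> fl fr x.
have /subvP sub : (<<[seq f j k | j <- enum 'I_3, k <- enum 'I_3]>> <=
    <<[:: f 0 0; f 0 1; f 1 0; f 1 1]%R>>)%VS.
  apply/span_subvP => _ /allpairsP[[j k] [_ _ ->]] /=; move: j k.
  elim/I3_ind2 => [||P0 P1 k]; last by rewrite fl memvD.
    by elim/I3_ind2 => [||P0 P1]; rewrite ?fr ?memvD // memv_span // !inE eqxx ?orbT.
  by elim/I3_ind2 => [||P0 P1]; rewrite ?fr ?memvD // memv_span // !inE eqxx ?orbT.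
(* [row] with j = 0 gives y and with j = 1 gives z, each zero or some u_k. *)
have row j a b : a *: f j 0 + b *: f j 1 = 0 \/ exists k, a *: f j 0 + b *: f j 1 = f j k.
  rewrite (F2_natE a) (F2_natE b).
  case: (a != 0); case: (b != 0); rewrite ?scale1r ?scale0r ?addr0 ?add0r.
  - by right; exists 2.
  - by right; exists 0.
  - by right; exists 1.
  - by left.
move=> /sub; rewrite !span_cons span_nil addv0.
case/memv_addP=> _ /vlineP[a ->] [y1 /memv_addP[_ /vlineP[b ->] [y2 Hy2 ->]] ->].
case/memv_addP: Hy2 => _ /vlineP[c ->] [_ /vlineP[d ->] ->]; rewrite addrA.
have [-> | [r ->]] := row 0 a b; have [-> | [s ->]] := row 1 c d.
- by exists 0, 0, 0, 0; rewrite add0r F2_addvv.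
- by exists 0, s, 2, s; rewrite fl addrA F2_addvv.
- by exists 1, r, 2, r; rewrite fl addrCA F2_addvv.
- by exists 0, r, 1, s.
Qed.

(** * The Segre variety in coordinates *)

Section Segre.
Variable u : 'I_3 -> V2.
Hypothesis (u_inj : injective u) (u_neq0 : forall i, u i != 0).

Lemma addu01_neq0 : u 0 + u 1 != 0.
Proof.
apply/eqP => s0; suff /u_inj : u 0 = u 1 by [].
by rewrite -[LHS]addr0 -(F2_addvv (u 1)) addrA s0 add0r.
Qed.

(** V2 has only three nonzero vectors, so u_0 + u_1 is one of the u_i. *)
Lemma u2E : u 2 = u 0 + u 1.
Proof.
have /eqP img : u @: setT == [set~ 0].
  rewrite eqEcard cardsC1 card_imset // cardsT card_ord card_mx card_Fp //= andbT.
  by apply/subsetP => _ /imsetP[i _ ->]; rewrite !inE.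
have: u 0 + u 1 \in [set~ 0] by rewrite !inE addu01_neq0.
rewrite -img => /imsetP[i _]; have [->|->|-> //] := I3P i => /eqP.
  by rewrite -[X in _ == X]addr0 (inj_eq (addrI _)) (negbTE (u_neq0 _)).
by rewrite -[X in _ == X]add0r (inj_eq (addIr _)) (negbTE (u_neq0 _)).
Qed.

Lemma u01_free a b : a *: u 0 + b *: u 1 = 0 -> a = 0 /\ b = 0.
Proof.
rewrite (F2_natE a) (F2_natE b).
case: (a != 0); case: (b != 0); rewrite ?scale1r ?scale0r ?addr0 ?add0r //.
- by move/eqP; rewrite (negbTE addu01_neq0).
- by move/eqP; rewrite (negbTE (u_neq0 _)).
- by move/eqP; rewrite (negbTE (u_neq0 _)).
Qed.

(** Peeling off the last tensor factor: read entrywise in the first factor, this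
    is the independence of u_0 and u_1. *)
Lemma tens_u01_free m (x y : 'rV['F_2]_m) : x *t u 0 + y *t u 1 = 0 -> x = 0 /\ y = 0.
Proof.
move=> xy0.
have ab i : x 0 i = 0 /\ y 0 i = 0.
  apply: u01_free; apply/rowP => j.
  have /matrixP/(_ (mxtens_index (0, 0)) (mxtens_index (i, j))) := xy0.
  by rewrite mxE !tensmxE !mxE.
by split; apply/rowP => i; rewrite mxE; case: (ab i).
Qed.

Lemma tens3_u01_free (x y z t : V2) :
  tens3 x (u 0) (u 0) + tens3 y (u 1) (u 0)
    + (tens3 z (u 0) (u 1) + tens3 t (u 1) (u 1)) = 0 ->
  [/\ x = 0, y = 0, z = 0 & t = 0].
Proof.
move=> xyzt0.
have [] : (x *t u 0 + y *t u 1 : 'rV_4) = 0 /\ (z *t u 0 + t *t u 1 : 'rV_4) = 0.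
  apply: tens_u01_free; rewrite -[RHS]xyzt0; congr (_ + _); exact: tens3E.
by move=> /(@tens_u01_free 2)[-> ->] /(@tens_u01_free 2)[-> ->].
Qed.

Lemma basis_e_basis : basis_of fullv (e_basis u).
Proof.
rewrite basisEfree subvf dimvf /dim /= !andbT; apply/freeP => k sum0.
pose c j := k (inord j); have kc i : k i = c i by rewrite /c inord_val.
pose e := [:: tens3 (u 0) (u 0) (u 0); tens3 (u 1) (u 0) (u 0);
              tens3 (u 1) (u 1) (u 0); tens3 (u 0) (u 1) (u 0);
              tens3 (u 1) (u 0) (u 1); tens3 (u 0) (u 0) (u 1);
              tens3 (u 0) (u 1) (u 1); tens3 (u 1) (u 1) (u 1)].
have {}sum0 : \sum_(0 <= i < 8) c i *: e`_i = 0.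
  by rewrite big_mkord -[RHS]sum0; apply: eq_bigr => i _; rewrite kc /= !E_tens3.
have [] : [/\ c 0 *: u 0 + c 1 *: u 1 = 0, c 3 *: u 0 + c 2 *: u 1 = 0,
              c 5 *: u 0 + c 4 *: u 1 = 0 & c 6 *: u 0 + c 7 *: u 1 = 0].
  apply: tens3_u01_free; apply: etrans sum0; rewrite unlock /= regroup8.
  by congr (_ + _ + (_ + _)); exact: tens3_comb.
move=> /u01_free[c0 c1] /u01_free[c3 c2] /u01_free[c5 c4] /u01_free[c6 c7] i.
by rewrite kc; case: i => [[|[|[|[|[|[|[|[|]]]]]]]] ].
Qed.

Definition of_bits (c : seq bool) : V8 :=
  \sum_(i < 8) (nth false c i)%:R *: (e_basis u)`_i.

Definition xor_bits (c d : seq bool) : seq bool :=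
  mkseq (fun i => nth false c i (+) nth false d i) 8.

Lemma coord_of_bits c i : coord (e_basis u) i (of_bits c) = (nth false c i)%:R.
Proof. exact: coord_sum_free (basis_free basis_e_basis). Qed.

Lemma of_bits_surj x : exists2 c, size c = 8%N & x = of_bits c.
Proof.
exists (mkseq (fun i => coord (e_basis u) (inord i) x != 0) 8).
  by rewrite size_mkseq.
rewrite [LHS](coord_basis basis_e_basis (memvf x)); apply: eq_bigr => i _.
by rewrite nth_mkseq // inord_val -F2_natE.
Qed.

Lemma of_bits_inj c d : size c = 8%N -> size d = 8%N -> of_bits c = of_bits d -> c = d.
Proof.
move=> sc sd eq_cd; apply: (@eq_from_nth _ false) => [|i]; rewrite sc ?sd // => lti.
have := congr1 (coord (e_basis u) (Ordinal lti)) eq_cd.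
by rewrite !coord_of_bits /=; do 2!case: nth.
Qed.

Lemma of_bitsD c d : of_bits (xor_bits c d) = of_bits c + of_bits d.
Proof.
rewrite -big_split; apply: eq_bigr => i _ /=; rewrite -scalerDl nth_mkseq //.
by congr (_ *: _); do 2!case: nth; apply: val_inj.
Qed.

Lemma of_bits0 : of_bits (nseq 8 false) = 0.
Proof.
by rewrite /of_bits big1 // => i _; rewrite nth_nseq if_same scale0r.
Qed.

Definition index3 := ('I_3 * 'I_3 * 'I_3)%type.
Definition segre_pt (t : index3) : V8 := E u t.1.1 t.1.2 t.2.

(** The coefficient of u_a in u_i, for a = 0 or 1. *)
Definition u_bit (a : nat) (i : 'I_3) : bool := (i == a :> nat) || (i == 2%N :> nat).

(** The coordinates of E_ijk; the list of triples (a, b, c) follows the order of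
    e_1, ..., e_8. *)
Definition segre_bits (t : index3) : seq bool :=
  [seq [&& u_bit a.1.1 t.1.1, u_bit a.1.2 t.1.2 & u_bit a.2 t.2]
     | a <- [:: (0, 0, 0); (1, 0, 0); (1, 1, 0); (0, 1, 0);
                (1, 0, 1); (0, 0, 1); (0, 1, 1); (1, 1, 1)]%N].

Lemma E2l j k : E u 2 j k = E u 0 j k + E u 1 j k.
Proof. by rewrite !E_tens3 u2E; exact: tens3Dl. Qed.

Lemma E2m i k : E u i 2 k = E u i 0 k + E u i 1 k.
Proof. by rewrite !E_tens3 u2E; exact: tens3Dm. Qed.

Lemma E2r i j : E u i j 2 = E u i j 0 + E u i j 1.
Proof. by rewrite !E_tens3 u2E; exact: tens3Dr. Qed.

Lemma segre_bits2l j k :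
  segre_bits (2, j, k) = xor_bits (segre_bits (0, j, k)) (segre_bits (1, j, k)).
Proof. by move: j k; do 2!elim/I3_ind2=> [||_ _]; vm_compute. Qed.

Lemma segre_bits2m i k :
  segre_bits (i, 2, k) = xor_bits (segre_bits (i, 0, k)) (segre_bits (i, 1, k)).
Proof. by move: i k; do 2!elim/I3_ind2=> [||_ _]; vm_compute. Qed.

Lemma segre_bits2r i j :
  segre_bits (i, j, 2) = xor_bits (segre_bits (i, j, 0)) (segre_bits (i, j, 1)).
Proof. by move: i j; do 2!elim/I3_ind2=> [||_ _]; vm_compute. Qed.

Lemma of_bits_unit (n : 'I_8) : of_bits (mkseq (eq_op (val n)) 8) = (e_basis u)`_n.
Proof.
rewrite /of_bits (bigD1 n) //= nth_mkseq // eqxx scale1r big1 ?addr0 // => i ne.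
by rewrite nth_mkseq //= val_eqE eq_sym (negbTE ne) scale0r.
Qed.

Lemma E_of_bits i j k : E u i j k = of_bits (segre_bits (i, j, k)).
Proof.
move: i j k; apply: I3_ind3.
- exact/esym/(of_bits_unit (@Ordinal 8 0 isT)).
- exact/esym/(of_bits_unit (@Ordinal 8 5 isT)).
- exact/esym/(of_bits_unit (@Ordinal 8 3 isT)).
- exact/esym/(of_bits_unit (@Ordinal 8 6 isT)).
- exact/esym/(of_bits_unit (@Ordinal 8 1 isT)).
- exact/esym/(of_bits_unit (@Ordinal 8 4 isT)).
- exact/esym/(of_bits_unit (@Ordinal 8 2 isT)).
- exact/esym/(of_bits_unit (@Ordinal 8 7 isT)).
- by move=> j k E0 E1; rewrite E2l E0 E1 segre_bits2l of_bitsD.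
- by move=> i k E0 E1; rewrite E2m E0 E1 segre_bits2m of_bitsD.
- by move=> i j E0 E1; rewrite E2r E0 E1 segre_bits2r of_bitsD.
Qed.

Lemma segre_pt_of_bits t : segre_pt t = of_bits (segre_bits t).
Proof. by case: t => [[i j] k]; apply: E_of_bits. Qed.

(** * Lines of the Segre variety and invariance *)

(** Literal ordinals, on which evaluation does not meet the opaque enumeration of
    'I_3. *)
Definition I3s : seq 'I_3 :=
  [:: @Ordinal 3 0 isT; @Ordinal 3 1 isT; @Ordinal 3 2 isT].

Definition index3s : seq index3 :=
  [seq (ij, k) | ij <- [seq (i, j) | i <- I3s, j <- I3s], k <- I3s].

Lemma mem_index3s t : t \in index3s.
Proof.
case: t => [[i j] k].
by have [->|->|->] := I3P i; have [->|->|->] := I3P j; have [->|->|->] := I3P k.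
Qed.

Definition share_index (p q : index3) : bool :=
  [|| p.1.1 == q.1.1, p.1.2 == q.1.2 | p.2 == q.2].

(** The lines contained in the Segre variety are the triples of points obtained by
    letting one index vary. *)
Definition collinear (p q : index3) : bool :=
  [|| (p.1.1 == q.1.1) && (p.1.2 == q.1.2),
      (p.1.1 == q.1.1) && (p.2 == q.2) | (p.1.2 == q.1.2) && (p.2 == q.2)].

(** To go from p to q inside the variety, change the two free indices one at a
    time; conversely, two lines change at most two of the three indices. *)
Lemma share_indexP p q : reflect (exists2 m, collinear p m & collinear m q) (share_index p q).
Proof.
apply: (iffP idP) => [|[m]].
  case: p q => [[i j] k] [[i' j'] k'] /or3P[] /= /eqP <-.
  - by exists (i, j', k); rewrite /collinear /= !eqxx ?orbT.
  - by exists (i', j, k); rewrite /collinear /= !eqxx ?orbT.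
  - by exists (i', j, k); rewrite /collinear /= !eqxx ?orbT.
rewrite /share_index => /or3P[] /andP[/eqP pm1 /eqP pm2] /or3P[] /andP[/eqP mq1 /eqP mq2];
  by rewrite pm1 pm2 ?mq1 ?mq2 eqxx ?orbT.
Qed.

Lemma size_segre_bits t : size (segre_bits t) = 8%N. Proof. by []. Qed.
Lemma size_xor_bits c d : size (xor_bits c d) = 8%N. Proof. exact: size_mkseq. Qed.

Lemma of_bits_eq0 c : size c = 8%N -> (of_bits c == 0) = (c == nseq 8 false).
Proof.
move=> sc; apply/eqP/eqP => [|->]; last exact: of_bits0.
by rewrite -of_bits0; apply: of_bits_inj.
Qed.

Lemma segre_pt_add p q :
  segre_pt p + segre_pt q = of_bits (xor_bits (segre_bits p) (segre_bits q)).
Proof. by rewrite of_bitsD !segre_pt_of_bits. Qed.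

Lemma mem_segreP x : reflect (exists t, x = segre_pt t) (x \in segre u).
Proof. by apply: (iffP imsetP) => [[t _ ->]|[t ->]]; exists t. Qed.

Lemma mem_segre_pt t : segre_pt t \in segre u.
Proof. by apply/mem_segreP; exists t. Qed.

Lemma collinear_bits :
  all (fun p => all (fun q => collinear p q ==
    (xor_bits (segre_bits p) (segre_bits q) \in nseq 8 false :: map segre_bits index3s))
    index3s) index3s.
Proof. by vm_compute. Qed.

(** A line over GF(2) is {p, q, p + q}; the point 0 accounts for p = q. *)
Lemma collinearE p q : collinear p q = (segre_pt p + segre_pt q \in 0 |: segre u).
Proof.
have /allP/(_ q (mem_index3s q))/eqP -> := allP collinear_bits p (mem_index3s p).
rewrite segre_pt_add in_setU1 in_cons of_bits_eq0 ?size_xor_bits //; congr (_ || _).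
apply/mapP/mem_segreP => [[t _ ->]|[t]]; first by exists t; rewrite segre_pt_of_bits.
rewrite segre_pt_of_bits => /of_bits_inj E; exists t; rewrite ?mem_index3s //.
by apply: E; rewrite ?size_xor_bits.
Qed.

Lemma segre_pt_neq0 t : segre_pt t != 0.
Proof.
rewrite segre_pt_of_bits of_bits_eq0 ?size_segre_bits //.
have nz : all (fun p => segre_bits p != nseq 8 false) index3s by vm_compute.
exact: (allP nz t (mem_index3s t)).
Qed.

Lemma has_map3 (I T : Type) (P : pred T) (f g h : I -> T) (r : seq I) :
  has P (map f r ++ map g r ++ map h r) =
  [|| has (P \o f) r, has (P \o g) r | has (P \o h) r].
Proof. by rewrite !has_cat !has_map. Qed.

(** A single Segre point is also such a sum, of the two other points of a line. *)
Lemma mem_flatsP x :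
  has (fun F : {vspace V8} => x \in F) (segre_flats u) <->
  exists p q, share_index p q /\ x = segre_pt p + segre_pt q.
Proof.
rewrite /segre_flats has_map3; split.
- case/or3P => /hasP[i _] /= /span_grid_sum2[||j [k [j' [k' ->]]]].
  + by move=> k; apply: E2m.
  + by move=> k; apply: E2r.
  + by exists (i, j, k), (i, j', k'); rewrite /share_index eqxx.
  + by move=> k; apply: E2l.
  + by move=> k; apply: E2r.
  + by exists (j, i, k), (j', i, k'); rewrite /share_index eqxx orbT.
  + by move=> k; apply: E2l.
  + by move=> k; apply: E2m.
  + by exists (j, k, i), (j', k', i); rewrite /share_index eqxx !orbT.
- case=> [[[i j] k] [[[i' j'] k'] [/or3P ag ->]]].
  apply/or3P; case: ag => /= /eqP <-; [apply: Or31|apply: Or32|apply: Or33].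
  + apply/hasP; exists i; rewrite ?mem_enum //=.
    by apply: memvD; apply: (mem_span_grid (fun j k => E u i j k)).
  + apply/hasP; exists j; rewrite ?mem_enum //=.
    by apply: memvD; apply: (mem_span_grid (fun i k => E u i j k)).
  + apply/hasP; exists k; rewrite ?mem_enum //=.
    by apply: memvD; apply: (mem_span_grid (fun i j => E u i j k)).
Qed.

Lemma mem_O2_O5P x :
  reflect (x != 0 /\ exists p q, share_index p q /\ x = segre_pt p + segre_pt q)
          (x \in O2 u :|: O5 u).
Proof.
suff -> : (x \in O2 u :|: O5 u) =
    (x != 0) && has (fun F : {vspace V8} => x \in F) (segre_flats u).
  by apply: (iffP andP) => -[x0 /mem_flatsP]; split.
rewrite [LHS]inE [_ \in O2 u]inE /O5.
have [/mem_segreP[t ->]|] := boolP (x \in segre u); last by rewrite orbF.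
rewrite orbT segre_pt_neq0 /=; apply/esym; rewrite /segre_flats has_map3.
case: t => [[i j] k]; apply/or3P/Or31/hasP.
exists i; rewrite ?mem_enum //=.
exact: (mem_span_grid (fun j k => E u i j k)).
Qed.

Lemma gl_act_inj (g : {'GL_8['F_2]}) : injective (gl_act g).
Proof. exact: can_inj (mulmxK (GL_unit g)). Qed.

(** The images of p, q and of the point joining them are again Segre points, and
    collinearity is expressed by sums alone. *)
Lemma stab_segre_O2_O5 g : g \in stab_segre u ->
  gl_act g @: (O2 u :|: O5 u) = O2 u :|: O5 u.
Proof.
rewrite inE => /eqP gS; apply/eqP.
rewrite eqEcard (card_imset _ (@gl_act_inj g)) leqnn andbT.
have gD x y : gl_act g (x + y) = gl_act g x + gl_act g y by apply: mulmxDl.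
have g0 : gl_act g 0 = 0 by apply: mul0mx.
have gpt t : exists t', gl_act g (segre_pt t) = segre_pt t'.
  by apply/mem_segreP; rewrite -gS imset_f ?mem_segre_pt.
have gcollinear p q p' q' :
    gl_act g (segre_pt p) = segre_pt p' -> gl_act g (segre_pt q) = segre_pt q' ->
    collinear p q -> collinear p' q'.
  move=> gp gq; rewrite !collinearE -gp -gq -gD => /setU1P[->|Spq].
    by rewrite g0 setU11.
  by rewrite setU1r // -gS imset_f.
apply/subsetP => _ /imsetP[x /mem_O2_O5P[x0 [p [q [/share_indexP[m pm mq] Dx]]]] ->].
apply/mem_O2_O5P; split; first by rewrite -g0 (inj_eq (@gl_act_inj g)).
have [[p' gp] [q' gq] [m' gm]] := And3 (gpt p) (gpt q) (gpt m).
exists p', q'; rewrite Dx gD gp gq; split=> //.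
by apply/share_indexP; exists m'; [apply: gcollinear gp gm pm | apply: gcollinear gm gq mq].
Qed.

(** * Evaluation on the 256 vectors *)

Fixpoint allbits n : seq (seq bool) :=
  if n is n'.+1 then map (cons false) (allbits n') ++ map (cons true) (allbits n')
  else [:: [::]].

Lemma mem_allbits c : c \in allbits (size c).
Proof.
by elim: c => //= b c IHc; rewrite mem_cat; case: b; rewrite map_f ?orbT.
Qed.

Lemma size_allbits n c : c \in allbits n -> size c = n.
Proof.
elim: n c => [|n IHn] c /=; first by rewrite inE => /eqP ->.
by rewrite mem_cat => /orP[] /mapP[d /IHn <- ->].
Qed.

(** The removal of duplicates only keeps the later membership tests short. *)
Definition secant_bits : seq (seq bool) :=
  undup [seq xor_bits (segre_bits w.1) (segre_bits w.2)
           | w <- [seq (p, q) | p <- index3s, q <- index3s] & share_index w.1 w.2].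

Definition O2_O5_bits : seq (seq bool) :=
  [seq c <- allbits 8 | (c != nseq 8 false) && (c \in secant_bits)].

Lemma mem_O2_O5_of_bits c : size c = 8%N -> (of_bits c \in O2 u :|: O5 u) = (c \in O2_O5_bits).
Proof.
move=> sc; have c8 : c \in allbits 8 by rewrite -sc mem_allbits.
rewrite mem_filter c8 andbT mem_undup.
rewrite -(of_bits_eq0 sc); apply/mem_O2_O5P/andP => -[c0].
  move=> [p [q [ag]]]; rewrite segre_pt_add => /of_bits_inj Dc; split=> //.
  apply/mapP; exists (p, q); last by apply: Dc; rewrite ?size_xor_bits.
  by rewrite mem_filter ag allpairs_f ?mem_index3s.
move=> /mapP[[p q]]; rewrite mem_filter => /andP[ag _] Dc.
by split=> //; exists p, q; rewrite segre_pt_add Dc.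
Qed.

Lemma card_O2_O5_bits : uniq O2_O5_bits && (size O2_O5_bits == 81%N).
Proof. by vm_compute. Qed.

Lemma card_of_bits (A : {set V8}) (s : seq (seq bool)) :
    uniq s -> {in s, forall c, size c = 8%N} ->
    (forall c, size c = 8%N -> (of_bits c \in A) = (c \in s)) -> #|A| = size s.
Proof.
move=> us s8 sA.
have uvs : uniq (map of_bits s).
  by rewrite map_inj_in_uniq // => c d /s8 sc /s8 sd; apply: of_bits_inj.
rewrite -(size_map of_bits) -(card_uniqP uvs).
apply: eq_card => x; have [c sc ->] := of_bits_surj x; rewrite sA //.
apply/idP/mapP => [|[d sd /of_bits_inj ->]] //; first by exists c.
exact: s8.
Qed.

Lemma card_O2_O5 : #|O2 u :|: O5 u| = 81%N.
Proof.
have /andP[uO /eqP <-] := card_O2_O5_bits; apply: card_of_bits uO _ mem_O2_O5_of_bits.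
by move=> c; rewrite mem_filter => /andP[_ /size_allbits].
Qed.

End Segre.

(** * The quartic polynomial *)

Definition Q4_mons : seq (seq nat) :=
  [:: [:: 1; 8]; [:: 2; 7]; [:: 3; 6]; [:: 4; 5]]%N
  ++ [:: [:: 1; 3; 5]; [:: 1; 3; 7]; [:: 1; 5; 7]; [:: 3; 5; 7];
         [:: 2; 4; 6]; [:: 2; 4; 8]; [:: 2; 6; 8]; [:: 4; 6; 8]]%N
  ++ [:: [:: 1; 3; 5; 7]; [:: 2; 4; 6; 8]]%N
  ++ [:: [:: 1; 2; 4; 8]; [:: 1; 2; 6; 8]; [:: 1; 4; 6; 8];
         [:: 1; 3; 5; 8]; [:: 1; 3; 7; 8]; [:: 1; 5; 7; 8];
         [:: 1; 2; 3; 7]; [:: 1; 2; 5; 7]; [:: 2; 3; 5; 7];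
         [:: 2; 4; 6; 7]; [:: 2; 4; 7; 8]; [:: 2; 6; 7; 8];
         [:: 2; 3; 4; 6]; [:: 2; 3; 6; 8]; [:: 3; 4; 6; 8];
         [:: 1; 3; 5; 6]; [:: 1; 3; 6; 7]; [:: 3; 5; 6; 7];
         [:: 1; 3; 4; 5]; [:: 1; 4; 5; 7]; [:: 3; 4; 5; 7];
         [:: 2; 4; 5; 6]; [:: 2; 4; 5; 8]; [:: 4; 5; 6; 8]]%N.

Lemma Q4E : Q4 = \sum_(s <- Q4_mons) mon s.
Proof. by rewrite /Q4 !big_cat -!addrA. Qed.

Definition mon_mnm (s : seq nat) : 'X_{1..8} :=
  [multinom nat_of_bool (i.+1 \in s) | i < 8].

Lemma monE s : mon s = 'X_[mon_mnm s].
Proof.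
rewrite mpolyXE_id /mon big_mkcond; apply: eq_bigr => i _.
by rewrite mnmE; case: ifP.
Qed.

Lemma mdeg_mon_mnm s : mdeg (mon_mnm s) = count (fun i => i.+1 \in s) (iota 0 8).
Proof.
rewrite mdegE -sum1_count [RHS]big_mkcond -[iota 0 8]/(index_iota 0 8) big_mkord.
by apply: eq_bigr => i _; rewrite mnmE; case: ifP.
Qed.

Lemma mon_mnm_eq s t :
  (mon_mnm s == mon_mnm t) = all (fun i => (i.+1 \in s) == (i.+1 \in t)) (iota 0 8).
Proof.
apply/eqP/allP => [st i|st].
  rewrite mem_iota => /= lti; have /mnmP/(_ (Ordinal lti)) := st.
  by rewrite !mnmE /=; do 2!case: (_ \in _).
by apply/mnmP => i; rewrite !mnmE (eqP (st i _)) // mem_iota /=.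
Qed.

Lemma sumr_count (R : pzSemiRingType) (T : Type) (P : pred T) (r : seq T) :
  \sum_(x <- r) (P x)%:R = (count P r)%:R :> R.
Proof. by rewrite -natr_sum -sumn_count sumnE big_map. Qed.

Lemma mcoeff_Q4 m : Q4@_m = (count (fun s => mon_mnm s == m) Q4_mons)%:R.
Proof.
rewrite Q4E raddf_sum -sumr_count; apply: eq_bigr => s _ /=.
by rewrite monE mcoeffX.
Qed.

Lemma msupp_Q4 m : m \in msupp Q4 -> exists2 s, s \in Q4_mons & m = mon_mnm s.
Proof.
rewrite mcoeff_msupp mcoeff_Q4 => nz.
suff /hasP[s Ss /eqP <-] : has (fun s => mon_mnm s == m) Q4_mons by exists s.
by rewrite has_count; case: count nz => //; rewrite eqxx.
Qed.

Lemma mdeg_Q4 m : m \in msupp Q4 -> (0 < mdeg m <= 4)%N.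
Proof.
have deg : all (fun s => 0 < count (fun i => i.+1 \in s) (iota 0 8) <= 4)%N Q4_mons.
  by vm_compute.
by case/msupp_Q4 => s Ss ->; rewrite mdeg_mon_mnm; apply: (allP deg s Ss).
Qed.

Lemma msize_Q4 : msize Q4 = 5%N.
Proof.
apply/eqP; rewrite eqn_leq; apply/andP; split.
  rewrite msizeE; apply/bigmax_leqP_seq => m /mdeg_Q4/andP[_ le4] _.
  by rewrite ltnS.
(* Any of the monomials of degree 4 witnesses that the degree is attained. *)
suff S : mon_mnm [:: 1; 3; 5; 7]%N \in msupp Q4.
  by have := msize_mdeg_lt S; rewrite mdeg_mon_mnm.
rewrite mcoeff_msupp mcoeff_Q4 (eq_count (fun s => mon_mnm_eq s _)).
by rewrite (_ : count _ _ = 1%N).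
Qed.

Lemma reduced_Q4 : reduced Q4.
Proof.
split=> [|m /msupp_Q4[s _ ->] i]; last by rewrite mnmE leq_b1.
by apply/eqP; rewrite mcoeff_eq0; apply/negP => /mdeg_Q4; rewrite mdeg0.
Qed.

Definition eval_mon_bits (s : seq nat) (c : seq bool) : bool :=
  all (fun i => (i.+1 \in s) ==> nth false c i) (iota 0 8).

Lemma meval_mon s c :
  (mon s).@[fun i => (nth false c i)%:R] = (eval_mon_bits s c)%:R :> 'F_2.
Proof.
rewrite monE mevalX /eval_mon_bits.
pose b i := (i.+1 \in s) ==> nth false c i.
have prod_bool (r : seq nat) : \prod_(i <- r) ((b i)%:R : 'F_2) = (all b r)%:R.
  elim: r => [|i r IHr]; first by rewrite big_nil.
  by rewrite big_cons IHr /=; case: (b i); rewrite ?mul1r ?mul0r.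
rewrite -prod_bool -[iota 0 8]/(index_iota 0 8) big_mkord; apply: eq_bigr => i _.
by rewrite mnmE /b; case: (_ \in _); case: nth.
Qed.

Lemma meval_Q4 c : Q4.@[fun i => (nth false c i)%:R] =
  (count (eval_mon_bits^~ c) Q4_mons)%:R.
Proof.
rewrite Q4E raddf_sum -sumr_count; apply: eq_bigr => s _ /=.
exact: meval_mon.
Qed.

Lemma F2_natr_eq0 n : (n%:R == 0 :> 'F_2) = ~~ odd n.
Proof.
rewrite -[n in LHS]odd_double_half natrD -muln2 natrM (_ : 2%:R = 0 :> 'F_2).
  by rewrite mulr0 addr0; case: odd.
exact: val_inj.
Qed.

(** The parity of the number of monomials of Q4 not vanishing at c is the value of
    Q4 at c. *)
Lemma Q4_bits : all (fun c => (c \in O2_O5_bits) ==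
  (c != nseq 8 false) && ~~ odd (count (eval_mon_bits^~ c) Q4_mons)) (allbits 8).
Proof. by vm_compute. Qed.

Lemma reduced_equation_Q4 u (u_inj : injective u) (u_neq0 : forall i, u i != 0) :
  reduced_equation (e_basis u) (O2 u :|: O5 u) Q4.
Proof.
split; first exact: reduced_Q4.
apply/setP => x; have [c sc ->] := of_bits_surj u_inj u_neq0 x.
have Dc : c \in allbits 8 by rewrite -sc mem_allbits.
rewrite mem_O2_O5_of_bits // (eqP (allP Q4_bits c Dc)) [in RHS]inE of_bits_eq0 //.
rewrite (meval_eq _ (coord_of_bits u_inj u_neq0 c)) meval_Q4.
by rewrite F2_natr_eq0.
Qed.

Unset Implicit Arguments.

(* msize Q is the degree of Q plus one. *)
Theorem theorem13 (u : 'I_3 -> V2) (u_inj : injective u)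
    (u_neq0 : forall i, u i != 0) :
  [/\ #|O2 u :|: O5 u| = 81%N,
      forall b : 8.-tuple V8, basis_of fullv b ->
        exists Q, unique (reduced_equation b (O2 u :|: O5 u)) Q
                  /\ msize Q = 5%N
    & forall g, g \in stab_segre u ->
        gl_act g @: (O2 u :|: O5 u) = O2 u :|: O5 u]
  /\ (basis_of fullv (e_basis u)
      /\ unique (reduced_equation (e_basis u) (O2 u :|: O5 u)) Q4).
Proof.
have be := basis_e_basis u_inj u_neq0; have eqQ4 := reduced_equation_Q4 u_inj u_neq0.
split; last first.
  by split=> //; split=> // Q; exact: (reduced_equation_uniq be eqQ4).
split; [exact: card_O2_O5 | move=> b bb | exact: stab_segre_O2_O5].
have [Q eqQ leQ] := reduced_equation_change bb eqQ4.
exists Q; split; first by split=> // Q'; exact: (reduced_equation_uniq bb eqQ).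
have [Q' eqQ' leQ'] := reduced_equation_change be eqQ.
rewrite -(reduced_equation_uniq be eqQ4 eqQ') msize_Q4 in leQ'.
by rewrite msize_Q4 in leQ; apply/eqP; rewrite eqn_leq leQ.
Qed.
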